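(* Let $0<p<1$, let $H_0,H_1$ be probability distributions on $\mathbb{R}$ with expected values $\mu(H_0)=0$ and $\mu(H_1)=1$, and let $X_1,X_2,\ldots$ be obtained from $H_0,H_1$ by exponential sampling with selection variables $B_0,B_1,\ldots$, as defined in the context. For $n=1,2,\ldots$ let ${\bf B}_n=(B_{n-1},\ldots,B_0)$, $S_n=\sum_{i=1}^{2^n-1}X_i$, $\bar X_n=S_n/(2^n-1)$ and $Y_n=E(\bar X_n\mid {\bf B}_n)$. Then for every $n\ge 1$: (i) With probability one, $Y_n$ assumes the values $y_k=y_{k,n}=k/(2^n-1)$, $k=0,1,\ldots,2^n-1$, and the difference between adjacent realizations is constant: $y_{l+1}-y_l=1/(2^n-1)$ for $l=0,\ldots,2^n-2$. (ii) Identify a binary vector ${\bf b}_n=(b_{n-1},\ldots,b_1,b_0)\in\{0,1\}^n$ with the number $k=\sum_{j=0}^{n-1}b_j2^j\in\{0,\ldots,2^n-1\}$ whose binary digits it lists. Then the probability $p_k=P(Y_n=y_k)$ is $$p_k=p^{\#1}(1-p)^{\#0}=p^{\sum_{i=0}^{n-1}b_i}(1-p)^{n-\sum_{i=0}^{n-1}b_i}\ge 0,$$ where $\#1$ and $\#0$ are the numbers of ones and zeros in ${\bf b}_n$. In particular, every $p_k$ has the form $p^l(1-p)^{n-l}$ for some $l\in\{0,\ldots,n\}$. (iii) The distributions of ${\bf B}_n$, $E(S_n\mid{\bf B}_n)$ and $Y_n$ are given explicitly as follows: for each $k\in\{0,\ldots,2^n-1\}$ with binary digit vector ${\bf b}_n=(b_{n-1},\ldots,b_0)$,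 the events ${\bf B}_n={\bf b}_n$, $E(S_n\mid{\bf B}_n)=k$ and $Y_n=y_{k,n}=k/(2^n-1)$ correspond to each other and each has probability $p_k$ as given in (ii). (iv) If ${\bf b}_n$ is the binary digit vector of $k$, then $$(2^n-1)\,y_{k,n}=E(S_n\mid{\bf B}_n={\bf b}_n)=\sum_{j=1}^{n}b_{j-1}2^{j-1}\in\{0,\ldots,2^n-1\}.$$
   Context: Exponential sampling: Given two parent distributions $H_0,H_1$ and $0<p<1$, let $B_0,B_1,B_2,\ldots$ be independent Bernoulli random variables with $P(B_j=1)=p$, $P(B_j=0)=1-p$. The sample $X_1;X_2,X_3;X_4,\ldots,X_7;\ldots;X_{2^{n-1}},\ldots,X_{2^n-1}$ of size $2^n-1$ consists of $n$ sub-samples, where sub-sample $j$ ($j=1,\ldots,n$) consists of the $2^{j-1}$ variables $X_{2^{j-1}},\ldots,X_{2^j-1}$. Conditional on $(B_0,\ldots,B_{n-1})$, all the $X_i$ are independent, and the variables of sub-sample $j$ are all distributed according to $H_1$ if $B_{j-1}=1$ and according to $H_0$ if $B_{j-1}=0$. *)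

(* Defs.v *)
From HB Require Import structures.
From mathcomp Require Import all_boot all_order all_algebra finmap.
From mathcomp Require Import all_classical all_reals all_analysis.
Set Implicit Arguments.
Unset Strict Implicit.
Unset Printing Implicit Defensive.
Import Order.TTheory GRing.Theory Num.Theory.
Import numFieldNormedType.Exports.
Local Open Scope classical_set_scope.
Local Open Scope ring_scope.

(* Elementary conditional probability Q(. | C) and conditional expectation
   E(Z | C), meaningful when 0 < P C. *)
Definition cprob d (T : measurableType d) (R : realType) (P : probability T R)
    (C A : set T) : \bar R :=
  ((fine (P C))^-1%:E * P (A `&` C))%E.

Definition cexp d (T : measurableType d) (R : realType) (P : probability T R)
    (C : set T) (Z : T -> R) : \bar R :=
  ((fine (P C))^-1%:E * \int[P]_(w in C) (Z w)%:E)%E.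

(* The variables X i, i in D, are mutually independent under Q.  Q is only a set
   function so that conditional probabilities can be used as well. *)
Definition mutually_independent d (T : measurableType d) d'
    (T' : measurableType d') (R : realType) (Q : set T -> \bar R)
    (D : set nat) (X : nat -> T -> T') : Prop :=
  forall J : {fset nat}, [set` J] `<=` D ->
  forall A : nat -> set T', (forall i, measurable (A i)) ->
    Q (\bigcap_(i in [set` J]) (X i @^-1` A i)) =
    (\prod_(i <- J) Q (X i @^-1` A i))%E.

(* Y is a version of E(Z | sigma(V)). *)
Definition is_condexp d (T : measurableType d) d' (T' : measurableType d')
    (R : realType) (P : probability T R) (V : T -> T') (Z Y : T -> R) : Prop :=
  let sigmaV := preimage_set_system setT V measurable in
  [/\ P.-integrable setT (EFin \o Z), P.-integrable setT (EFin \o Y),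
      forall A : set R, measurable A -> sigmaV (Y @^-1` A) &
      forall G, sigmaV G ->
        (\int[P]_(w in G) (Y w)%:E = \int[P]_(w in G) (Z w)%:E)%E].

(* Binary vectors (b_{n-1}, ..., b_0) are tuples b with b_j = tnth b j, that is,
   listed with the least significant digit first. *)
Definition Bvec (T : Type) (B : nat -> T -> bool) (n : nat) (w : T) :
    n.-tuple bool :=
  [tuple B j w | j < n].

Definition binval (n : nat) (b : n.-tuple bool) : nat :=
  (\sum_(j < n) tnth b j * 2 ^ j)%N.

(* The sample is indexed from 1; X 0 plays no role.  The j-th sub-sample
   (1 <= j <= n) is {X i | 2 ^ (j - 1) <= i < 2 ^ j}; below it is indexed by
   j - 1. *)
Record exponential_sampling d (T : measurableType d) (R : realType)
    (P : probability T R) (H0 H1 : probability R R) (p : R)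
    (B : nat -> T -> bool) (X : nat -> T -> R) : Prop := {
  sel_indep : mutually_independent P setT B ;
  sel_bernoulli : forall j, P (B j @^-1` [set true]) = p%:E /\
                            P (B j @^-1` [set false]) = (1 - p)%:E ;
  sample_indep : forall n (b : n.-tuple bool),
    mutually_independent (cprob P (Bvec B n @^-1` [set b]))
      [set i | (1 <= i < 2 ^ n)%N] X ;
  sample_law : forall n (b : n.-tuple bool) (j : 'I_n) i,
    (2 ^ j <= i < 2 ^ j.+1)%N -> forall A : set R, measurable A ->
    cprob P (Bvec B n @^-1` [set b]) (X i @^-1` A) =
    (if tnth b j then H1 else H0) A }.

Definition sample_sum (T : Type) (R : realType) (X : nat -> T -> R) (n : nat)
    (w : T) : R :=
  \sum_(1 <= i < 2 ^ n) X i w.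

Definition sample_mean (T : Type) (R : realType) (X : nat -> T -> R) (n : nat)
    (w : T) : R :=
  sample_sum X n w / (2 ^ n - 1)%:R.

Definition yval (R : realType) (n k : nat) : R := k%:R / (2 ^ n - 1)%:R.

(* Main.v *)
Require Import Defs.
From HB Require Import structures.
From mathcomp Require Import all_boot all_order all_algebra finmap.
From mathcomp Require Import all_classical all_reals all_analysis measurable_realfun.
Import Order.TTheory GRing.Theory Num.Theory.
Import numFieldNormedType.Exports.
Local Open Scope classical_set_scope.
Local Open Scope ring_scope.

(** Two facts carry the proof.

    Every fibre [B_n = b] of the selection vector has positive probability, as
    [0 < p < 1], and there are finitely many of them.  A version [Y] of
    [E(Z | B_n)] is measurable for the sigma-algebra generated by [B_n], hence
    constant on each fibre, and the averaging property over a fibre of positive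
    probability forces the constant to be the mean of [Z] there.  So there is
    exactly one version, equal everywhere, and not only almost surely, to
    [g (B_n)] with [g b] the mean of [Z] on the fibre of [b]
    ([is_condexp_finite], [is_condexp_finite_unique]).  This is why the events
    of the theorem are equal as sets.

    On the fibre of [b] the variables of the block [2 ^ j <= i < 2 ^ j.+1] have
    law [H1] or [H0] according to the digit [b_j], hence mean [b_j]; transferring
    the integral to the law is [integral_cond_law].  The block has [2 ^ j]
    elements, so the mean of the sum is [\sum_j b_j 2 ^ j], the number with
    binary digits [b] ([integral_sample_sum]).

    Since binary expansion is a bijection between [{0, 1} ^ n] and
    [{0, ..., 2 ^ n - 1}] ([binval_bij]), the conditional expectation determines
    [B_n], and its distribution is the one of [n] independent Bernoulli
    variables ([prob_Bvec]). *)

(** * Integrals under a conditional law *)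

Section conditional_law.
Local Open Scope ereal_scope.
Context {d : measure_display} {T : measurableType d} {R : realType}.
Context {d' : measure_display} {T' : measurableType d'}.
Variables (P : probability T R) (H : probability T' R).
Variables (C : set T) (mC : measurable C) (C_gt0 : 0 < P C).
Variables (X : T -> T') (mX : measurable_fun [set: T] X).
Hypothesis law : forall A, measurable A -> cprob P C (X @^-1` A) = H A.

(** The law of [X] under [P] restricted to [C] is [P C] times [H], so this is a
    change of variables; the restriction is a genuine measure, which lets the
    transfer theorem for image measures apply. *)
Lemma ge0_integral_cond_law (f : T' -> \bar R) :
  measurable_fun [set: T'] f -> (forall x, 0 <= f x) ->
  \int[P]_(w in C) f (X w) = P C * \int[H]_x f x.
Proof.
move=> mf f0.
have PCfin : P C \is a fin_num by exact: fin_num_measure.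
have c_gt0 : (0 < fine (P C))%R by rewrite fine_gt0// C_gt0 ltey_eq PCfin.
pose Q := mrestr P mC.
have -> : \int[P]_(w in C) f (X w) = \int[Q]_w f (X w).
  transitivity (\int[Q]_(w in C) f (X w)).
    apply: eq_measure_integral => A mA /setIidl AC.
    by rewrite -[in LHS]AC.
  (* The restricted measure does not charge the complement of C. *)
  rewrite [RHS](@ge0_negligible_integral _ _ _ _ _ (~` C)) ?setDE ?setCK ?setTI//.
  - by apply: measurableC.
  - by apply: (measurableT_comp mf mX).
  - by rewrite /= /Q /mrestr setICl measure0.
have -> : \int[Q]_w f (X w) = \int[pushforward Q X]_x f x.
  by rewrite ge0_integral_pushforward.
pose c := NngNum (ltW c_gt0).
rewrite (@eq_measure_integral _ _ _ _ (mscale c H))//; last first.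
  move=> A mA _; rewrite /= /mscale/= -law// /cprob muleA -EFinM divff ?gt_eqF//.
  by rewrite mul1e.
by rewrite ge0_integral_mscale//= fineK.
Qed.

Lemma integrable_cond_law (f : T' -> \bar R) :
  H.-integrable [set: T'] f -> P.-integrable C (f \o X).
Proof.
move=> /integrableP[mf foo]; apply/integrableP; split.
  by apply: measurable_funTS; exact: measurableT_comp.
rewrite (ge0_integral_cond_law (abse \o f))//.
- by rewrite lte_mul_pinfty// fin_num_measure.
- by apply: measurableT_comp.
- by move=> x /=; exact: abse_ge0.
Qed.

Lemma integral_cond_law (f : T' -> \bar R) :
  H.-integrable [set: T'] f -> \int[P]_(w in C) f (X w) = P C * \int[H]_x f x.
Proof.
move=> fi; have mf := measurable_int _ fi.
rewrite [in RHS]integralE muleBr ?fin_num_measure ?integrable_add_def//.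
rewrite -!ge0_integral_cond_law//.
- by rewrite integralE funepos_comp funeneg_comp.
- exact: measurable_funeneg.
- exact: measurable_funepos.
Qed.

End conditional_law.

(** * Conditioning on a variable with finitely many values *)

Section finite_conditioning.
Local Open Scope ereal_scope.
Context {d : measure_display} {T : measurableType d} {R : realType}.
Context {d' : measure_display} {T' : measurableType d'}.
Variables (P : probability T R) (V : T -> T').
Hypothesis finT' : finite_set [set: T'].
Hypothesis m_set1 : forall t : T', measurable [set t].
Hypothesis mV : measurable_fun [set: T] V.

Let mfibre t : measurable (V @^-1` [set t]).
Proof. by rewrite -[X in measurable X]setTI; exact: mV. Qed.

Lemma measurable_finite_codomain (A : set T') : measurable A.
Proof.
rewrite -(image_id A) -bigcup_imset1.
by apply: fin_bigcup_measurable => //; exact: sub_finite_set finT'.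
Qed.

(** Enumerating the fibres makes finite additivity of the integral available:
    it reduces integrability and the averaging property to single fibres. *)
Lemma preimage_fibres (A : set T') : exists2 s : seq T', uniq s &
  V @^-1` A = \big[setU/set0]_(t <- s) V @^-1` [set t].
Proof.
have /finite_seqP[s As] : finite_set A by exact: sub_finite_set finT'.
exists (undup s); first exact: undup_uniq.
rewrite -bigcup_seq; apply/seteqP; split=> w /=.
  by rewrite As => Vw; exists (V w); rewrite //= mem_undup.
by move=> [t /=]; rewrite mem_undup As /= => ts ->.
Qed.

Let trivIset_fibres (D : set T') : trivIset D (fun t => V @^-1` [set t]).
Proof. by move=> t u _ _ [w [/= <- <-]]. Qed.

Lemma integrable_fibres (Z : T -> R) : measurable_fun [set: T] Z ->
  (forall t, P.-integrable (V @^-1` [set t]) (EFin \o Z)) ->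
  P.-integrable [set: T] (EFin \o Z).
Proof.
move=> mZ iZ; have mEZ : measurable_fun [set: T] (EFin \o Z) by exact/measurable_EFinP.
apply/integrableP; split=> //.
rewrite -(preimage_setT V); have [s us ->] := preimage_fibres setT.
rewrite ge0_integral_bigsetU//.
- apply: lte_sum_pinfty => t _.
  by have /integrableP[] := iZ t.
- by apply: measurable_funTS; exact: measurableT_comp.
Qed.

Lemma eq_integral_fibres (Y Z : T -> R) :
  measurable_fun [set: T] Y -> measurable_fun [set: T] Z ->
  (forall t, \int[P]_(w in V @^-1` [set t]) (Y w)%:E =
             \int[P]_(w in V @^-1` [set t]) (Z w)%:E) ->
  forall A, \int[P]_(w in V @^-1` A) (Y w)%:E =
            \int[P]_(w in V @^-1` A) (Z w)%:E.
Proof.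
move=> mY mZ YZ A; have [s us ->] := preimage_fibres A.
rewrite !integral_bigsetU_EFin//; last 2 first.
- by apply: measurable_funTS; exact: measurableT_comp.
- by apply: measurable_funTS; exact: measurableT_comp.
by apply: eq_bigr => t _; exact: YZ.
Qed.

Let integral_fibre_const (Y : T -> R) t y :
  (forall w, V w = t -> Y w = y) ->
  \int[P]_(w in V @^-1` [set t]) (Y w)%:E = y%:E * P (V @^-1` [set t]).
Proof.
move=> Yy; rewrite -integral_cst//; apply: eq_integral => w.
by rewrite inE => /Yy ->.
Qed.

Variables (Z : T -> R) (g : T' -> R).
Hypothesis gE : forall t,
  \int[P]_(w in V @^-1` [set t]) (Z w)%:E = (g t)%:E * P (V @^-1` [set t]).

Lemma is_condexp_finite :
  P.-integrable [set: T] (EFin \o Z) -> is_condexp P V Z (g \o V).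
Proof.
move=> iZ; have mg : measurable_fun [set: T] (g \o V).
  move=> _ A _; rewrite comp_preimage; apply: mV => //.
  exact: measurable_finite_codomain.
have mZ : measurable_fun [set: T] Z.
  by apply/measurable_EFinP; exact: measurable_int iZ.
split=> //.
- apply: integrable_fibres => // t.
  apply: (eq_integrable _ (EFin \o cst (g t))) => //.
    by move=> w; rewrite inE /= => ->.
  exact: finite_measure_integrable_cst.
- move=> A _; exists (g @^-1` A); first exact: measurable_finite_codomain.
  by rewrite setTI.
- move=> _ [A _ <-]; rewrite setTI; apply: eq_integral_fibres => // t.
  by rewrite gE; apply: integral_fibre_const => w /= ->.
Qed.

(** Pointwise uniqueness: a function measurable for the sigma-algebra of [V]
    cannot vary on a fibre of [V], and a fibre of positive probability
    determines the constant. *)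
Lemma is_condexp_finite_unique (Y : T -> R) :
  (forall t, 0 < P (V @^-1` [set t])) -> is_condexp P V Z Y ->
  forall w, Y w = g (V w).
Proof.
move=> P_gt0 [_ _ Ysigma Yint] w.
(* The preimage under Y of the point Y w has the form V^-1 B, so it contains
   with w its whole fibre. *)
have Ycst w' : V w' = V w -> Y w' = Y w.
  have [B _ YB] := Ysigma [set Y w] (measurable_set1 _).
  have : (V @^-1` B) w by rewrite -[V @^-1` B]setTI YB.
  by move=> + Vw' => /=; rewrite -Vw' -[B (V w')]/((V @^-1` B) w') -[V @^-1` B]setTI YB.
have /Yint : preimage_set_system setT V measurable (V @^-1` [set V w]).
  by exists [set V w]; [exact: m_set1|rewrite setTI].
rewrite gE (integral_fibre_const _ _ _ Ycst) => /eqP.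
have PV : P (V @^-1` [set V w]) \is a fin_num by exact: fin_num_measure.
rewrite -(fineK PV) -!EFinM eqe => /eqP; apply: mulIf.
by rewrite gt_eqF// fine_gt0// P_gt0 ltey_eq PV.
Qed.

End finite_conditioning.

(** * Binary expansions and dyadic blocks *)

Lemma binary_sum_lt (f : nat -> bool) n : (\sum_(j < n) f j * 2 ^ j < 2 ^ n)%N.
Proof.
elim: n => [|n IHn]; first by rewrite big_ord0.
rewrite big_ord_recr /= expnS mul2n -addnn -addSn leq_add//.
by case: (f n); rewrite ?mul1n ?mul0n.
Qed.

(** Division by [2 ^ i] kills the digits below [i], which sum to less than
    [2 ^ i], and leaves the digits above [i] with an even weight. *)
Lemma binary_digit (f : nat -> bool) n i : (i < n)%N ->
  odd ((\sum_(j < n) f j * 2 ^ j) %/ 2 ^ i) = f i.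
Proof.
elim: n => // n IHn; rewrite ltnS leq_eqVlt => /predU1P[->|i_lt_n].
  rewrite big_ord_recr /= divnDMl ?expn_gt0// divn_small ?binary_sum_lt//.
  by case: (f n).
have top : (f n * 2 ^ n = f n * 2 ^ (n - i.+1) * 2 * 2 ^ i)%N.
  by rewrite -!mulnA -expnS -expnD subnK.
rewrite big_ord_recr /= top [X in (X %/ _)%N]addnC divnMDl ?expn_gt0//.
by rewrite oddD IHn// oddM andbF.
Qed.

Lemma binvalE n (b : n.-tuple bool) :
  binval b = (\sum_(j < n) nth false b j * 2 ^ j)%N.
Proof. by apply: eq_bigr => j _; rewrite (tnth_nth false). Qed.

Lemma binval_lt n (b : n.-tuple bool) : (binval b < 2 ^ n)%N.
Proof. by rewrite binvalE binary_sum_lt. Qed.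

Lemma binval_inj n : injective (@binval n).
Proof.
move=> b c bc; apply: eq_from_tnth => i; rewrite !(tnth_nth false).
by rewrite -(binary_digit _ _ _ (ltn_ord i)) -binvalE bc binvalE binary_digit.
Qed.

(** Injectivity is reading off the digits; surjectivity then follows by
    counting, both sides having [2 ^ n] elements. *)
Lemma binval_bij n : set_bij [set: n.-tuple bool] `I_(2 ^ n) (@binval n).
Proof.
split=> [b _|b c _ _|k /= k_lt]; [exact: binval_lt|exact: binval_inj|].
pose h (b : n.-tuple bool) := Ordinal (binval_lt n b).
have h_inj : injective h by move=> b c /(congr1 val); exact: binval_inj.
have [|h' _ hK] := inj_card_bij h_inj.
  by rewrite card_ord card_tuple card_bool.
by exists (h' (Ordinal k_lt)) => //; rewrite -[LHS]/(val (h _)) hK.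
Qed.

Lemma binval_nth n (b : n.-tuple bool) :
  binval b = (\sum_(1 <= j < n.+1) nth false b j.-1 * 2 ^ j.-1)%N.
Proof. by rewrite binvalE big_add1 /= big_mkord. Qed.

Lemma big_dyadic (S : nmodType) (F : nat -> S) n :
  \sum_(1 <= i < 2 ^ n) F i = \sum_(j < n) \sum_(2 ^ j <= i < 2 ^ j.+1) F i.
Proof.
elim: n => [|n IHn]; first by rewrite big_ord0 big_geq.
rewrite big_ord_recr /= -IHn -big_cat_nat//; first by rewrite expn_gt0.
by rewrite leq_exp2l.
Qed.

Lemma dyadic_block n i : (1 <= i < 2 ^ n)%N ->
  exists j : 'I_n, (2 ^ j <= i < 2 ^ j.+1)%N.
Proof.
move=> /andP[i_gt0 i_lt]; have := trunc_log_bounds (ltnSn 1) i_gt0.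
move=> /andP[lo hi].
have k_lt : (trunc_log 2 i < n)%N.
  by rewrite -(ltn_exp2l _ _ (ltnSn 1)) (leq_ltn_trans lo).
by exists (Ordinal k_lt); rewrite /= lo hi.
Qed.

Lemma count_mem_true_tnth n (b : n.-tuple bool) :
  count_mem true b = (\sum_(i < n) tnth b i)%N.
Proof.
rewrite -sum1_count big_mkcond big_tuple.
by apply: eq_bigr => i _; case: (tnth b i).
Qed.

Lemma count_mem_false_tnth n (b : n.-tuple bool) :
  count_mem false b = (n - \sum_(i < n) tnth b i)%N.
Proof.
have sizeE : (count_mem true b + count_mem false b = n)%N.
  rewrite -[RHS](size_tuple b) -(count_predC (pred1 true)).
  by congr addn; apply: eq_count => -[].
by rewrite -count_mem_true_tnth -[X in (X - _)%N]sizeE addKn.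
Qed.

Lemma sample_size_neq0 (R : realType) n : (1 <= n)%N -> (2 ^ n - 1)%:R != 0 :> R.
Proof.
by move=> n_gt0; rewrite pnatr_eq0 -lt0n subn_gt0 -(expn0 2) ltn_exp2l.
Qed.

Lemma yval_inj (R : realType) n : (1 <= n)%N -> injective (yval R n).
Proof.
move=> n_gt0 k l /(mulIf (invr_neq0 (sample_size_neq0 R n n_gt0)))/eqP.
by rewrite eqr_nat => /eqP.
Qed.

(** * Exponential sampling *)

Lemma finite_tuple_bool n : finite_set [set: n.-tuple bool].
Proof. exact: finite_finset. Qed.

Lemma measurable_tuple_bool1 n (b : n.-tuple bool) : measurable [set b].
Proof.
have -> : [set b] =
    \bigcap_(i in [set: 'I_n])
      ((fun c : n.-tuple bool => tnth c i) @^-1` [set tnth b i]).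
  apply/seteqP; split=> [_ -> //|c cb].
  by apply: eq_from_tnth => i; exact: cb.
apply: fin_bigcap_measurable => // i _.
by rewrite -[X in measurable X]setTI; exact: measurable_tnth.
Qed.

Section sampling.
Context {d : measure_display} {T : measurableType d} {R : realType}.
Variables (P : probability T R) (p : R) (H0 H1 : probability R R).
Variables (B : nat -> {RV P >-> bool}) (X : nat -> {RV P >-> R}).
Hypothesis p01 : 0 < p < 1.
Hypothesis H0_int : H0.-integrable [set: R] (fun x => x%:E).
Hypothesis H0_mean : (\int[H0]_x x%:E = 0)%E.
Hypothesis H1_int : H1.-integrable [set: R] (fun x => x%:E).
Hypothesis H1_mean : (\int[H1]_x x%:E = 1)%E.
Hypothesis expS : exponential_sampling P H0 H1 p B X.

Lemma measurable_Bvec n : measurable_fun [set: T] (Bvec B n).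
Proof.
apply/measurable_fun_tnthP => i.
apply: (eq_measurable_fun (B i)); last exact: measurable_funP.
by move=> w _; rewrite /= tnth_mktuple.
Qed.

Lemma measurable_atom n (b : n.-tuple bool) : measurable (Bvec B n @^-1` [set b]).
Proof.
rewrite -[X in measurable X]setTI; apply: measurable_Bvec => //.
exact: measurable_tuple_bool1.
Qed.

Lemma prob_Bvec n (b : n.-tuple bool) :
  P (Bvec B n @^-1` [set b]) =
  (p ^+ count_mem true b * (1 - p) ^+ count_mem false b)%:E.
Proof.
pose J := [fset i in iota 0 n]%fset.
have JE i : (i \in J) = (i < n)%N by rewrite !inE mem_iota.
have -> : Bvec B n @^-1` [set b] =
    \bigcap_(i in [set` J]) (B i @^-1` [set nth false b i]).
  apply/seteqP; split=> [w <- i Ji|w Jw /=].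
    have i_lt_n : (i < n)%N by rewrite -JE.
    have := tnth_mktuple (fun j => B j w) (Ordinal i_lt_n).
    by rewrite (tnth_nth false).
  apply: eq_from_tnth => i; rewrite tnth_mktuple (tnth_nth false).
  by apply: Jw; rewrite /= JE.
rewrite (sel_indep expS)//.
have pE i : P (B i @^-1` [set nth false b i]) =
    (if nth false b i then p else 1 - p)%:E.
  by have [] := sel_bernoulli expS i; case: nth.
rewrite (perm_big (iota 0 n)); last first.
  apply: uniq_perm; [exact: fset_uniq|exact: iota_uniq|].
  by move=> i; rewrite JE mem_iota.
under eq_bigr do rewrite pE.
rewrite prodEFin; congr EFin.
rewrite -[X in iota _ X]subn0 -/(index_iota 0 n) big_mkord.
transitivity (\prod_(x <- b) if x then p else 1 - p).
  by rewrite big_tuple; apply: eq_bigr => i _; rewrite (tnth_nth false).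
elim: (tval b) => [|x s IHs]; first by rewrite big_nil mulr1.
rewrite big_cons IHs; case: x; rewrite /= ?add0n ?add1n exprS.
  by rewrite mulrA.
by rewrite mulrCA.
Qed.

Lemma prob_atom_gt0 n (b : n.-tuple bool) : (0 < P (Bvec B n @^-1` [set b]))%E.
Proof.
have /andP[p_gt0 p_lt1] := p01.
by rewrite prob_Bvec lte_fin mulr_gt0 ?exprn_gt0 ?subr_gt0.
Qed.

(** On the fibre of [b] the mean of a variable of block [j] is the digit [b_j]:
    this is where the means [0] and [1] of [H0] and [H1] enter. *)
Lemma sample_atom n (b : n.-tuple bool) (j : 'I_n) i : (2 ^ j <= i < 2 ^ j.+1)%N ->
  P.-integrable (Bvec B n @^-1` [set b]) (EFin \o X i) /\
  (\int[P]_(w in Bvec B n @^-1` [set b]) (X i w)%:E =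
    (tnth b j)%:R%:E * P (Bvec B n @^-1` [set b]))%E.
Proof.
move=> ij; have mC := measurable_atom n b; have C_gt0 := prob_atom_gt0 n b.
have mX : measurable_fun [set: T] (X i) by exact: measurable_funP.
have law := sample_law expS b ij.
split; case: (tnth b j) law => law.
- exact: (integrable_cond_law P H1 _ mC C_gt0 _ mX law _ H1_int).
- exact: (integrable_cond_law P H0 _ mC C_gt0 _ mX law _ H0_int).
- rewrite (integral_cond_law P H1 _ mC C_gt0 _ mX law _ H1_int) H1_mean.
  by rewrite mule1 mul1e.
- rewrite (integral_cond_law P H0 _ mC C_gt0 _ mX law _ H0_int) H0_mean.
  by rewrite mule0 mul0e.
Qed.

(** The conditional laws only control [X i] on the fibres of a selection vector
    long enough to contain the block of [i]; length [i] is enough since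
    [i < 2 ^ i]. *)
Lemma integrable_sample i : (0 < i)%N -> P.-integrable [set: T] (EFin \o X i).
Proof.
move=> i_gt0; have [|j ij] := dyadic_block i i.
  by rewrite i_gt0 ltn_expl.
apply: (integrable_fibres P (Bvec B i)) => //.
- exact: finite_tuple_bool.
- exact: measurable_tuple_bool1.
- exact: measurable_Bvec.
- by move=> b; have [] := sample_atom i b j i ij.
Qed.

(* Indexed from 0, the sum runs over variables that are all integrable, which
   may fail for X 0. *)
Let sample_sumE n : EFin \o sample_sum X n =
  (fun w => \sum_(0 <= i < (2 ^ n).-1) (X i.+1 w)%:E)%E.
Proof.
by apply/funext => w; rewrite /= /sample_sum big_add1 sumEFin.
Qed.

Lemma integrable_sample_sum n : P.-integrable [set: T] (EFin \o sample_sum X n).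
Proof.
rewrite sample_sumE; apply: integrable_sum => // i _.
exact: integrable_sample.
Qed.

(** Grouping by blocks turns [2 ^ j] equal means [b_j] into the binary weight of
    the digit [b_j]. *)
Lemma integral_sample_sum n (b : n.-tuple bool) :
  (\int[P]_(w in Bvec B n @^-1` [set b]) (sample_sum X n w)%:E =
   (binval b)%:R%:E * P (Bvec B n @^-1` [set b]))%E.
Proof.
have mC := measurable_atom n b.
transitivity (\sum_(0 <= i < (2 ^ n).-1)
    \int[P]_(w in Bvec B n @^-1` [set b]) (X i.+1 w)%:E)%E.
  rewrite -integral_sum//.
    apply: eq_integral => w _.
    by rewrite -[LHS]/((EFin \o sample_sum X n) w) sample_sumE.
  by move=> i; apply: integrableS (integrable_sample i.+1 _).
rewrite -(big_add1 _ _ 0 (2 ^ n) xpredT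
  (fun i => \int[P]_(w in Bvec B n @^-1` [set b]) (X i w)%:E)%E).
rewrite big_dyadic.
transitivity (\sum_(j < n) ((tnth b j * 2 ^ j)%:R%:E * P (Bvec B n @^-1` [set b])))%E.
  have /fineK <- : P (Bvec B n @^-1` [set b]) \is a fin_num by exact: fin_num_measure.
  set q := fine _; apply: eq_bigr => j _.
  transitivity (\sum_(2 ^ j <= i < 2 ^ j.+1) ((tnth b j)%:R * q)%:E)%E.
    apply: eq_big_nat => i ij; rewrite (sample_atom n b j i ij).2 EFinM fineK//.
    exact: fin_num_measure.
  rewrite sumEFin sumr_const_nat expnS mul2n -addnn addnK -EFinM.
  by rewrite natrM mulrAC mulr_natr.
rewrite -ge0_sume_distrl; last by move=> j _; rewrite lee_fin.
by rewrite sumEFin -natr_sum.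
Qed.

Let sample_meanE n : EFin \o sample_mean X n =
  (fun w => ((2 ^ n - 1)%:R^-1)%:E * (EFin \o sample_sum X n) w)%E.
Proof. by apply/funext => w; rewrite /= /sample_mean mulrC EFinM. Qed.

Lemma integrable_sample_mean n :
  P.-integrable [set: T] (EFin \o sample_mean X n).
Proof.
by rewrite sample_meanE; apply: integrableZl => //; exact: integrable_sample_sum.
Qed.

Lemma integral_sample_mean n (b : n.-tuple bool) :
  (\int[P]_(w in Bvec B n @^-1` [set b]) (sample_mean X n w)%:E =
   (yval R n (binval b))%:E * P (Bvec B n @^-1` [set b]))%E.
Proof.
transitivity (((2 ^ n - 1)%:R^-1)%:E *
    \int[P]_(w in Bvec B n @^-1` [set b]) (sample_sum X n w)%:E)%E.
  rewrite -integralZl//; last 2 first.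
  - exact: measurable_atom.
  - apply: integrableS (integrable_sample_sum n) => //.
    exact: measurable_atom.
  apply: eq_integral => w _.
  by rewrite -[LHS]/((EFin \o sample_mean X n) w) sample_meanE.
by rewrite integral_sample_sum muleA -EFinM mulrC.
Qed.

End sampling.

(** * The conditional expectations given the selection vector *)

Theorem theorem2 (d : measure_display) (T : measurableType d) (R : realType)
    (P : probability T R) (p : R) (H0 H1 : probability R R)
    (B : nat -> {RV P >-> bool}) (X : nat -> {RV P >-> R}) :
  0 < p < 1 ->
  H0.-integrable [set: R] (fun x => x%:E) ->
  (\int[H0]_x x%:E = 0)%E ->
  H1.-integrable [set: R] (fun x => x%:E) ->
  (\int[H1]_x x%:E = 1)%E ->
  exponential_sampling P H0 H1 p B X ->
  forall n : nat, (1 <= n)%N ->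
  (exists ES : T -> R, is_condexp P (Bvec B n) (sample_sum X n) ES) /\
  (exists Y : T -> R, is_condexp P (Bvec B n) (sample_mean X n) Y) /\
  forall ES Y : T -> R,
  is_condexp P (Bvec B n) (sample_sum X n) ES ->
  is_condexp P (Bvec B n) (sample_mean X n) Y ->
  (* (i) *)
  (P [set w | exists2 k, (k < 2 ^ n)%N & Y w = yval R n k] = 1%E /\
   forall l, (l.+1 < 2 ^ n)%N ->
     yval R n l.+1 - yval R n l = 1 / (2 ^ n - 1)%:R) /\
  (* (ii) *)
  (set_bij [set: n.-tuple bool] `I_(2 ^ n) (@binval n) /\
   (forall b : n.-tuple bool,
     let pk := P (Y @^-1` [set yval R n (binval b)]) in
     [/\ pk = (p ^+ count_mem true b * (1 - p) ^+ count_mem false b)%:E,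
         pk = (p ^+ (\sum_(i < n) tnth b i) *
               (1 - p) ^+ (n - \sum_(i < n) tnth b i))%:E &
         (0 <= pk)%E]) /\
   (forall k, (k < 2 ^ n)%N -> exists2 l, (l <= n)%N &
     P (Y @^-1` [set yval R n k]) = (p ^+ l * (1 - p) ^+ (n - l))%:E)) /\
  (* (iii) *)
  (forall (k : nat) (b : n.-tuple bool), (k < 2 ^ n)%N -> binval b = k ->
     let pk := (p ^+ count_mem true b * (1 - p) ^+ count_mem false b)%:E in
     [/\ Bvec B n @^-1` [set b] = ES @^-1` [set k%:R],
         Bvec B n @^-1` [set b] = Y @^-1` [set yval R n k],
         P (Bvec B n @^-1` [set b]) = pk,
         P (ES @^-1` [set k%:R]) = pk &
         P (Y @^-1` [set yval R n k]) = pk]) /\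
  (* (iv) *)
  (forall (k : nat) (b : n.-tuple bool), (k < 2 ^ n)%N -> binval b = k ->
     [/\ ((2 ^ n - 1)%:R * yval R n k)%:E =
           cexp P (Bvec B n @^-1` [set b]) (sample_sum X n),
         cexp P (Bvec B n @^-1` [set b]) (sample_sum X n) =
           (\sum_(1 <= j < n.+1) nth false b j.-1 * 2 ^ j.-1)%N%:R%:E &
         (\sum_(1 <= j < n.+1) nth false b j.-1 * 2 ^ j.-1 < 2 ^ n)%N]).
Proof.
move=> p01 H0i H0m H1i H1m expS n n_gt0.
have finV := finite_tuple_bool n.
have mV1 := measurable_tuple_bool1 n.
have mV := measurable_Bvec P B n.
have V_gt0 := prob_atom_gt0 P p H0 H1 B X p01 expS n.
have sumE := integral_sample_sum P p H0 H1 B X p01 H0i H0m H1i H1m expS n.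
have meanE := integral_sample_mean P p H0 H1 B X p01 H0i H0m H1i H1m expS n.
have sumI := integrable_sample_sum P p H0 H1 B X p01 H0i H0m H1i H1m expS n.
have meanI := integrable_sample_mean P p H0 H1 B X p01 H0i H0m H1i H1m expS n.
have probV := prob_Bvec P p H0 H1 B X expS n.
split.
  exists ((fun b => (binval b)%:R) \o Bvec B n).
  exact: (is_condexp_finite P _ finV mV1 mV _ (fun b => (binval b)%:R) sumE).
split.
  exists ((fun b => yval R n (binval b)) \o Bvec B n).
  exact: (is_condexp_finite P _ finV mV1 mV _
    (fun b => yval R n (binval b)) meanE).
move=> ES Y cES cY.
have ESE := is_condexp_finite_unique P _ mV1 mV _ (fun b => (binval b)%:R)
  sumE _ V_gt0 cES.
have YE := is_condexp_finite_unique P _ mV1 mV _ (fun b => yval R n (binval b))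
  meanE _ V_gt0 cY.
have ES_event b : Bvec B n @^-1` [set b] = ES @^-1` [set (binval b)%:R].
  apply/seteqP; split=> w /=; first by move=> <-.
  by rewrite ESE => /eqP; rewrite eqr_nat => /eqP /binval_inj.
have Y_event b : Bvec B n @^-1` [set b] = Y @^-1` [set yval R n (binval b)].
  apply/seteqP; split=> w /=; first by move=> <-.
  by rewrite YE => /(yval_inj _ _ n_gt0) /binval_inj.
have [_ _ binval_surj] := binval_bij n.
split; [split|split; [split; [exact: binval_bij|split]|split]].
- rewrite [X in P X](_ : _ = setT) ?probability_setT//.
  by apply/seteqP; split=> // w _; exists (binval (Bvec B n w)); rewrite ?YE// binval_lt.
- by move=> l _; rewrite /yval -mulrBl -natrB// subSnn.
- move=> b pk; have pkE : pk = (p ^+ count_mem true b * (1 - p) ^+ count_mem false b)%:E.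
    by rewrite /pk -Y_event probV.
  split=> //; last by rewrite /pk measure_ge0.
  by rewrite pkE count_mem_false_tnth count_mem_true_tnth.
- move=> k /binval_surj[b _ <-]; exists (\sum_(i < n) tnth b i)%N.
    by rewrite -count_mem_true_tnth -[X in (_ <= X)%N](size_tuple b) count_size.
  by rewrite -Y_event probV count_mem_false_tnth count_mem_true_tnth.
- by move=> k b _ <- pk; split; rewrite -?ES_event -?Y_event ?probV.
- move=> k b _ <-.
  have cexpE : cexp P (Bvec B n @^-1` [set b]) (sample_sum X n) = (binval b)%:R%:E.
    have Pfin : P (Bvec B n @^-1` [set b]) \is a fin_num.
      by apply: fin_num_measure; exact: measurable_atom.
    rewrite /cexp sumE muleCA -[X in (_ * (_ * X))%E]fineK// -EFinM mulVf ?mulr1//.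
    by rewrite gt_eqF// fine_gt0// V_gt0 ltey_eq Pfin.
  rewrite cexpE -binval_nth binval_lt; split=> //; congr EFin.
  by rewrite /yval mulrC divfK// sample_size_neq0.
Qed.
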